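(* Let $L$ be a Lie algebra in $\mathrm{Ver}_4^+$ whose underlying object is $P$, with basis $x,x'$ where $x'=dx$. Then $L$ is isomorphic to one of the following: (a) the abelian Lie algebra $P_a$ (all brackets zero); (b) the Lie algebra $P_s$ with $[x,x]=0$, $[x',x]=x'$; (c) the Lie algebra $P_n$ with $[x,x]=x'$, $[x',x]=0$. These three Lie algebras are pairwise non-isomorphic.
   Context: Let $k$ be an algebraically closed field of characteristic $2$. $\mathrm{Ver}_4^+$ is the symmetric tensor category whose objects are finite-dimensional $k$-vector spaces $V$ with a linear endomorphism $d$, $d^2=0$ (write $x'=dx$), morphisms are linear maps commuting with $d$, $d$ acts on tensor products by $d\otimes1+1\otimes d$, and the braiding is $c(v\otimes w)=w\otimes v+w'\otimes v'$. $P$ is the two-dimensional object $k[d]/d^2$. A Lie algebra in $\mathrm{Ver}_4^+$ is an object with a bilinear bracket $[\cdot,\cdot]$ satisfying $d[x,y]=[x',y]+[x,y']$; $[x,y]+[y,x]+[y',x']=0$; $[[x,y],z]+[[z,x],y]+[[y,z],x]+[[x',y],z']+[[z',x],y']+[[y',z],x']=0$; and $[x,x]=0$ whenever $x'=0$. (In particular $[x',x']=0$, and $[x,y]=[y,x]$ if $y\in\ker d$.) Isomorphisms are linear bijections commuting with $d$ and preserving the bracket. *)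

(* Defs.v *)
From HB Require Import structures.
From mathcomp Require Import all_boot all_algebra.
From mathcomp Require Import ring.

Set Implicit Arguments.
Unset Strict Implicit.
Unset Printing Implicit Defensive.

Import GRing.Theory.
Local Open Scope ring_scope.

(* Objects of Ver_4^+. A [vectType] is finite-dimensional. *)
Record ver4_obj (k : fieldType) := Ver4Obj {
  ver4_space :> vectType k;
  diff : {linear ver4_space -> ver4_space};
  diff_sq : forall v, diff (diff v) = 0
}.

Arguments diff {k V} : rename.

Definition ver4_iso (k : fieldType) (V W : ver4_obj k) : Prop :=
  exists f : {linear V -> W},
    bijective f /\ forall v, f (diff v) = diff (f v).

Definition lie_axioms (k : fieldType) (V : ver4_obj k)
    (br : V -> V -> V) : Prop :=
  [/\ forall x y, diff (br x y) = br (diff x) y + br x (diff y),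
      forall x y, br x y + br y x + br (diff y) (diff x) = 0,
      forall x y z,
        br (br x y) z + br (br z x) y + br (br y z) x
        + br (br (diff x) y) (diff z) + br (br (diff z) x) (diff y)
        + br (br (diff y) z) (diff x) = 0
    & forall x, diff x = 0 -> br x x = 0].

Record ver4_lie (k : fieldType) := Ver4Lie {
  lie_obj :> ver4_obj k;
  bracket : {bilinear lie_obj -> lie_obj -> lie_obj};
  bracketP : lie_axioms bracket
}.

Arguments bracket {k L} : rename.

Definition lie_iso (k : fieldType) (L M : ver4_lie k) : Prop :=
  exists f : {linear L -> M},
    [/\ bijective f,
        forall v, f (diff v) = diff (f v)
      & forall v w, f (bracket v w) = bracket (f v) (f w)].

(* The object P = k[d]/d^2, in coordinates: the row vector (a, b) stands for
   a + b d, so that [Px] is 1, [Px'] is d, and the differential is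
   multiplication by d. *)
Definition P_diff (k : fieldType) : {linear 'rV[k]_2 -> 'rV[k]_2} :=
  mulmxr (delta_mx 0 1 : 'M[k]_2).

Lemma P_diffE (k : fieldType) (u : 'rV[k]_2) :
  P_diff k u = u 0 0 *: delta_mx 0 1.
Proof.
rewrite /P_diff /=; apply/rowP => j; rewrite !mxE big_ord_recl big_ord1 !mxE.
by rewrite /= mulr0 addr0.
Qed.

Lemma P_diff_sq (k : fieldType) (u : 'rV[k]_2) : P_diff k (P_diff k u) = 0.
Proof. by rewrite !P_diffE !mxE /= mulr0 scale0r. Qed.

Definition P (k : fieldType) : ver4_obj k := Ver4Obj (@P_diff_sq k).

Definition Px (k : fieldType) : P k := delta_mx 0 0 : 'rV[k]_2.
Definition Px' (k : fieldType) : P k := diff (Px k).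

Lemma Px'E (k : fieldType) : Px' k = delta_mx 0 1 :> 'rV[k]_2.
Proof. by rewrite /Px' [LHS]P_diffE mxE /= scale1r. Qed.

(* In any Lie algebra on P one has [x', x'] = 0 and [x, x'] = [x', x], so the
   bracket is determined by p = [x, x] and q = [x', x]. *)
Definition P_bracket (k : fieldType) (p q u v : P k) : P k :=
  let c (w : 'rV[k]_2) i := w 0 i in
  (c u 0 * c v 0) *: p + (c u 0 * c v 1 + c u 1 * c v 0) *: q.

Lemma P_bracket_bilinear (k : fieldType) (p q : P k) :
  bilinear_for ( *:%R) ( *:%R) (P_bracket p q).
Proof. by split=> u a v w; apply/rowP => j; rewrite !mxE; ring. Qed.

HB.instance Definition _ (k : fieldType) (p q : P k) :=
  bilinear_isBilinear.Build k (P k) (P k) (P k) _ _ (P_bracket p q)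
    (P_bracket_bilinear p q).

Lemma P_bracketxx (k : fieldType) (p q : P k) : P_bracket p q (Px k) (Px k) = p.
Proof. by apply/rowP => j; rewrite !mxE /=; ring. Qed.

Lemma P_bracketx'x (k : fieldType) (p q : P k) :
  P_bracket p q (Px' k) (Px k) = q.
Proof. by rewrite Px'E; apply/rowP => j; rewrite !mxE /=; ring. Qed.

Lemma P_bracket_lie (k : fieldType) (hk : 2%N \in [pchar k]) (a b : k) :
  a * b = 0 -> lie_axioms (P_bracket (a *: Px' k) (b *: Px' k)).
Proof.
move=> ab0; have k2 : 2%:R = 0 :> k by exact: pcharf0 hk.
have dE (u : P k) : diff u = (u : 'rV[k]_2) 0 0 *: delta_mx 0 1 :> 'rV[k]_2.
  exact: P_diffE.
split=> [u v|u v|u v w|u].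
- rewrite !dE Px'E; apply/rowP => j; rewrite !mxE /=.
  set u0 := u 0 0; set v0 := v 0 0.
  transitivity (2%:R * (b * u0 * v0 * (j == 1)%:R)); last by ring.
  by rewrite k2; ring.
- rewrite !dE Px'E; apply/rowP => j; rewrite !mxE /=.
  set u0 := u 0 0; set v0 := v 0 0; set u1 := u 0 1; set v1 := v 0 1.
  transitivity (2%:R * ((a * u0 * v0 + b * (u0 * v1 + u1 * v0)) * (j == 1)%:R)).
    by ring.
  by rewrite k2 mul0r.
- rewrite !dE Px'E; apply/rowP => j; rewrite !mxE /=.
  set u0 := u 0 0; set v0 := v 0 0; set w0 := w 0 0.
  set u1 := u 0 1; set v1 := v 0 1; set w1 := w 0 1.
  transitivity (a * b * (3%:R * (u0 * v0 * w0) * (j == 1)%:R)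
    + 2%:R * (b * b * (u0 * v1 * w0 + u1 * v0 * w0 + u0 * v0 * w1) * (j == 1)%:R)).
    by ring.
  by rewrite k2 ab0 !mul0r addr0.
rewrite dE => /rowP/(_ 1); rewrite !mxE /= mulr1 => u0.
apply/rowP => j; rewrite !mxE /= u0; ring.
Qed.

Lemma P_a_lie (k : fieldType) (hk : 2%N \in [pchar k]) :
  lie_axioms (P_bracket (0 : P k) 0).
Proof. by have := P_bracket_lie hk (mulr0 0); rewrite !scale0r. Qed.

Lemma P_s_lie (k : fieldType) (hk : 2%N \in [pchar k]) :
  lie_axioms (P_bracket 0 (Px' k)).
Proof. by have := P_bracket_lie hk (mul0r 1); rewrite scale0r scale1r. Qed.

Lemma P_n_lie (k : fieldType) (hk : 2%N \in [pchar k]) :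
  lie_axioms (P_bracket (Px' k) 0).
Proof. by have := P_bracket_lie hk (mulr0 1); rewrite scale0r scale1r. Qed.

Definition P_a (k : fieldType) (hk : 2%N \in [pchar k]) : ver4_lie k :=
  @Ver4Lie k (P k) (P_bracket 0 0) (P_a_lie hk).
Definition P_s (k : fieldType) (hk : 2%N \in [pchar k]) : ver4_lie k :=
  @Ver4Lie k (P k) (P_bracket 0 (Px' k)) (P_s_lie hk).
Definition P_n (k : fieldType) (hk : 2%N \in [pchar k]) : ver4_lie k :=
  @Ver4Lie k (P k) (P_bracket (Px' k) 0) (P_n_lie hk).

Lemma P_a_abelian (k : fieldType) (hk : 2%N \in [pchar k]) (u v : P_a hk) :
  bracket u v = 0.
Proof. by rewrite /bracket /= /P_bracket !scaler0 addr0. Qed.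

(* Main.v *)
Require Import Defs.
From mathcomp Require Import all_boot all_algebra.
From mathcomp Require Import ring.

(** The bracket of a Lie algebra on [P] is determined by [[x, x]] and
    [[x', x]]. Both are killed by [d]: the Leibniz rule gives
    [d [x, x] = [x', x] + [x, x'] = 2 [x', x] = 0] and
    [d [x', x] = [x', x'] = 0]. As the kernel of [d] on [P] is spanned by [x'],
    there are scalars with [[x, x] = a x'] and [[x', x] = b x'], and the Jacobi
    identity at [(x, x, x)] becomes [a b = 0] ([bracket_normal_form]).

    Replacing [x] by a nonzero multiple rescales [(a, b)] by a nonzero scalar
    ([scale_lie_iso]). So [(a, b)] can be brought to [(0, 0)], [(0, 1)] or
    [(1, 0)], which are [P_a], [P_s] and [P_n].

    These are told apart by which of the expressions [[v, w]] and [[v', v]]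
    vanish identically: both do in [P_a], only the second does in [P_n], and
    neither does in [P_s]. *)

Set Implicit Arguments.
Unset Strict Implicit.
Unset Printing Implicit Defensive.

Import GRing.Theory.
Local Open Scope ring_scope.

Section FieldOfCharacteristicTwo.

Variables (k : fieldType) (hk : 2%N \in [pchar k]).

Lemma addvv_pchar2 (V : lmodType k) (v : V) : v + v = 0.
Proof. by rewrite -mulr2n -scaler_nat (pcharf0 hk) scale0r. Qed.

Lemma P_decomp (u : P k) :
  u = (u : 'rV[k]_2) 0 0 *: Px k + (u : 'rV[k]_2) 0 1 *: Px' k.
Proof.
rewrite Px'E; apply/rowP => j; rewrite !mxE /=.
by case: j => [[|[|//]] lt_j]; rewrite /= ?mulr1 ?mulr0 ?addr0 ?add0r;
  congr (fun_of_matrix u _ _); apply: val_inj.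
Qed.

Lemma Px'_neq0 : Px' k != 0.
Proof.
apply/eqP; rewrite Px'E => /rowP/(_ 1); rewrite !mxE /= => /eqP.
by rewrite oner_eq0.
Qed.

Lemma P_diff_eq0 (u : P k) :
  diff u = 0 -> u = (u : 'rV[k]_2) 0 1 *: Px' k.
Proof.
move=> du0; rewrite {1}[u]P_decomp; set a := (u : 'rV[k]_2) 0 0.
suff -> : a = 0 by rewrite scale0r add0r.
have := P_diffE u; rewrite -[LHS]/(diff u) du0 => /rowP/(_ 1).
by rewrite !mxE /= mulr1.
Qed.

(** Since [[x', x'] = 0] and [[x, x'] = [x', x]], the bracket is determined by
    [[x, x]] and [[x', x]], and the Leibniz rule puts both in [ker d], the line
    of [x']. The Jacobi identity at [(x, x, x)] reads
    [3 [[x, x], x] + 3 [[x', x], x'] = 0]; here the second term is a multiple of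
    [[x', x'] = 0] and the first is [3 a b x' = a b x']. *)
Lemma bracket_normal_form (L : ver4_lie k) (g : {linear L -> P k}) :
    bijective g -> (forall v, g (diff v) = diff (g v)) ->
  exists a b : k, a * b = 0 /\
    forall v w,
      g (bracket v w) = P_bracket (a *: Px' k) (b *: Px' k) (g v) (g w).
Proof.
move=> [h gK hK] gd; have g_inj := can_inj gK.
have [leib anti jac alt] := bracketP L.
pose x := h (Px k); pose y : L := diff x.
have gx : g x = Px k by apply: hK.
have gy : g y = Px' k by rewrite gd gx.
have dy : diff y = 0 by apply: diff_sq.
have yy : bracket y y = 0 by apply: alt.
have xy : bracket x y = bracket y x.
  have := anti x y; rewrite dy linear0l addr0 => /(canRL (addrK _)) ->.
  by rewrite sub0r; apply/esym/eqP; rewrite -addr_eq0 addvv_pchar2.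
have kerP (z : L) : diff z = 0 -> exists c : k, z = c *: y.
  move=> dz; exists ((g z : 'rV[k]_2) 0 1); apply: g_inj.
  by rewrite linearZ gy; apply: P_diff_eq0; rewrite -gd dz linear0.
have [a xxE] : exists a : k, bracket x x = a *: y.
  by apply: kerP; rewrite leib -/y xy addvv_pchar2.
have [b yxE] : exists b : k, bracket y x = b *: y.
  by apply: kerP; rewrite leib dy linear0l add0r.
exists a, b; split.
  have := jac x x x; rewrite -/y xxE yxE !linearZl_LR /= yy yxE !scaler0 !addr0.
  rewrite addvv_pchar2 add0r scalerA => /(congr1 g).
  by rewrite linearZ linear0 gy => /eqP; rewrite scaler_eq0 (negPf Px'_neq0)
    orbF => /eqP.
have decomp (v : L) :
    v = (g v : 'rV[k]_2) 0 0 *: x + (g v : 'rV[k]_2) 0 1 *: y.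
  by apply: g_inj; rewrite linearD !linearZ /= gx gy; apply: P_decomp.
move=> v w; rewrite {1}[v]decomp {1}[w]decomp.
rewrite linearDl !linearDr !linearZl_LR !linearZr_LR /= yy xy xxE yxE.
rewrite !linearD !linearZ /= gy linear0 !scaler0 addr0 /P_bracket.
rewrite !scalerA -!scalerDl; congr (_ *: _); ring.
Qed.

Lemma P_bracket_scale (c : k) (p q u v : P k) :
  P_bracket p q (c *: u) (c *: v) = c *: P_bracket (c *: p) (c *: q) u v.
Proof. by apply/rowP => j; rewrite !mxE; ring. Qed.

(** Sending [x] to [c x] is an automorphism of the object [P], so it carries
    the bracket with structure constants [c p], [c q] to the one with [p], [q].
    The target is an arbitrary Lie algebra on [P] whose bracket is
    [P_bracket p q], so as to cover the three models at once. *)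
Lemma scale_lie_iso (L : ver4_lie k) (g : {linear L -> P k}) (c : k) (p q : P k)
    (M_lie : lie_axioms (P_bracket p q)) :
    bijective g -> (forall v, g (diff v) = diff (g v)) -> c != 0 ->
    (forall v w,
       g (bracket v w) = P_bracket (c *: p) (c *: q) (g v) (g w)) ->
  lie_iso L (@Ver4Lie k (P k) (P_bracket p q) M_lie).
Proof.
move=> [h gK hK] gd c0 gbr; exists (c \*: g); split=> [|v|v w].
- exists (fun u => h (c^-1 *: u)) => u; rewrite /GRing.scale_fun /=.
    by rewrite scalerA mulVf // scale1r gK.
  by rewrite hK scalerA mulfV // scale1r.
- by rewrite [LHS]/= gd -linearZ.
- by rewrite /= gbr P_bracket_scale.
Qed.

Lemma P_lie_classification (L : ver4_lie k) :
  ver4_iso L (P k) ->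
  lie_iso L (P_a hk) \/ lie_iso L (P_s hk) \/ lie_iso L (P_n hk).
Proof.
move=> [g [g_bij gd]].
have [a [b [/eqP ab0 gbr]]] := bracket_normal_form g_bij gd.
move: ab0; rewrite mulf_eq0; have [a0 _|a_neq0 /= /eqP b0] := eqVneq a 0.
  have [b0|b_neq0] := eqVneq b 0.
    left; apply: (@scale_lie_iso L g 1) => // [|v w]; first exact: oner_neq0.
    by rewrite gbr a0 b0 !scale0r !scaler0.
  right; left; apply: (@scale_lie_iso L g b) => // v w.
  by rewrite gbr a0 scale0r scaler0.
right; right; apply: (@scale_lie_iso L g a) => // v w.
by rewrite gbr b0 scale0r scaler0.
Qed.

Lemma lie_iso_abelian (L M : ver4_lie k) :
    lie_iso L M -> (forall v w : L, bracket v w = 0) ->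
  forall v w : M, bracket v w = 0.
Proof.
move=> [f [[h fK hK] _ fbr]] L0 v w.
by rewrite -[v]hK -[w]hK -fbr L0 linear0.
Qed.

Lemma P_n_bracket_diff (u v : P_n hk) : bracket (diff u) v = 0.
Proof.
rewrite -[diff u]/(P_diff k u) P_diffE.
by apply/rowP => j; rewrite !mxE /=; ring.
Qed.

Lemma P_a_not_iso_P_s : ~ lie_iso (P_a hk) (P_s hk).
Proof.
move=> /lie_iso_abelian/(_ (@P_a_abelian k hk))/(_ (Px' k) (Px k)).
by move/eqP; rewrite [bracket _ _]P_bracketx'x (negPf Px'_neq0).
Qed.

Lemma P_a_not_iso_P_n : ~ lie_iso (P_a hk) (P_n hk).
Proof.
move=> /lie_iso_abelian/(_ (@P_a_abelian k hk))/(_ (Px k) (Px k)).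
by move/eqP; rewrite [bracket _ _]P_bracketxx (negPf Px'_neq0).
Qed.

(** An isomorphism would send [x' = [x', x]] to [[(f x)', f x]], which vanishes
    in [P_n]. *)
Lemma P_s_not_iso_P_n : ~ lie_iso (P_s hk) (P_n hk).
Proof.
move=> [f [/bij_inj f_inj fd fbr]].
have := fbr (Px' k) (Px k); rewrite [X in f X]P_bracketx'x.
rewrite /Px' fd P_n_bracket_diff -fd -(linear0 f) => /f_inj x'0.
by case/eqP: Px'_neq0.
Qed.

End FieldOfCharacteristicTwo.

Theorem proposition4p6 (k : closedFieldType) (hk : 2%N \in [pchar k]) :
  (forall L : ver4_lie k, ver4_iso L (P k) ->
     lie_iso L (P_a hk) \/ lie_iso L (P_s hk) \/ lie_iso L (P_n hk))
  /\ [/\ ~ lie_iso (P_a hk) (P_s hk),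
         ~ lie_iso (P_a hk) (P_n hk)
       & ~ lie_iso (P_s hk) (P_n hk)].
Proof.
split; first exact: P_lie_classification.
split; [exact: P_a_not_iso_P_s | exact: P_a_not_iso_P_n|].
exact: P_s_not_iso_P_n.
Qed.
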